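(* For every integer $n \ge 1$ with binary representation $n = \sum_{i \ge 0} b_i 2^i$, $b_i \in \{0,1\}$, let $B(n) = \sum_{i \ge 0} b_i p^i$, where $p$ is the smallest prime factor of $n$ (and $B(1) = 1$). Then $B(n) \equiv m(n-1) \pmod 2$ for all $n \ge 1$.
   Context: For a non-negative integer $k$, $s_2(k)$ denotes the number of ones in the binary expansion of $k$. Define $\bar{t}(k) = 1$ if $s_2(k)$ is even and $\bar{t}(k)=0$ if $s_2(k)$ is odd. The sequence $m(n)$, $n \ge 0$, is defined by $m(2k) = \bar{t}(k)$ and $m(2k+1) = 0$ for all $k \ge 0$. The sequence $B(n)$ is OEIS A092524 (the binary representation of $n$ interpreted in base $p$), indexed from $n=1$: $1,2,4,4,26,6,57,8,28,10,1343,\ldots$. *)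

(* Defs.v *)
From mathcomp Require Import all_boot.

Set Implicit Arguments.
Unset Strict Implicit.
Unset Printing Implicit Defensive.

(* The binary digit b_i of n = \sum_i b_i 2 ^ i. *)
Definition bit (n i : nat) : nat := (n %/ 2 ^ i) %% 2.

(* Truncating at i < n loses nothing: bit n i = 0 as soon as n <= i, because
   n < 2 ^ n. *)
Lemma bit_expansion (n : nat) : n = \sum_(i < n) bit n i * 2 ^ i.
Proof.
have E k : n = \sum_(i < k) bit n i * 2 ^ i + n %/ 2 ^ k * 2 ^ k.
  elim: k => [|k IHk]; first by rewrite big_ord0 expn0 divn1 muln1.
  rewrite big_ord_recr /= {1}IHk -addnA; congr (_ + _).
  rewrite {1}(divn_eq (n %/ 2 ^ k) 2) -divnMA -expnSr mulnDl addnC.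
  by rewrite -mulnA -expnS.
by rewrite {1}(E n) (divn_small (ltn_expl n (ltnSn 1))) addn0.
Qed.

Definition s2 (k : nat) : nat := \sum_(i < k) bit k i.

Definition tbar (k : nat) : nat := if odd (s2 k) then 0 else 1.

Definition m (n : nat) : nat := if odd n then 0 else tbar n./2.

(* pdiv n is the smallest prime factor of n when 1 < n. *)
Definition B (n : nat) : nat :=
  if n == 1 then 1 else \sum_(i < n) bit n i * pdiv n ^ i.

(* Main.v *)
(* If n is even then p = 2, so B n = n is even and n - 1 is odd. If n = 2k + 1
   then p is odd, so B n has the parity of s2 n = s2 k + 1. *)
Require Import Defs.
From mathcomp Require Import all_boot.

(** Modulo 2 only the parity of the base p matters. For odd n every power of p is odd, so [B n] has
    the parity of the number of binary ones ([odd_digit_sum]); deleting the last digit of n = 2k + 1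
    removes exactly one of them ([s2_doubleS]), and the flipped parity is [tbar k]. For even n the
    base is 2, and [bit_expansion] gives back n. *)

Lemma bit_small (n i : nat) : n <= i -> bit n i = 0.
Proof.
move=> le_ni; rewrite /bit divn_small //.
exact: leq_ltn_trans le_ni (ltn_expl i (ltnSn 1)).
Qed.

(** Since [s2] truncates at its own argument, digit sums of different numbers have different ranges;
    padding with zero digits makes them comparable. *)
Lemma s2_widen (n k : nat) : n <= k -> \sum_(i < k) bit n i = s2 n.
Proof.
move=> le_nk; rewrite /s2 -!(big_mkord xpredT (bit n)) (big_cat_nat (leq0n n) le_nk) /=.
rewrite [X in _ + X]big_nat_cond [X in _ + X]big1 ?addn0 // => i.
by rewrite andbT => /andP[le_ni _]; apply: bit_small.
Qed.

Lemma s2_doubleS (k : nat) : s2 k.*2.+1 = (s2 k).+1.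
Proof.
rewrite /s2 big_ord_recl /bit expn0 divn1 modn2 /= odd_double -/(s2 k).
have le_k2k : k <= k.*2 by rewrite -addnn leq_addr.
rewrite add1n -(s2_widen k k.*2) //; congr _.+1.
apply: eq_bigr => i _.
by rewrite /bit /bump add1n expnS divnMA divn2 /= uphalf_double.
Qed.

Lemma odd_sum (k : nat) (F : 'I_k -> nat) :
  odd (\sum_(i < k) F i) = \big[addb/false]_(i < k) odd (F i).
Proof. by rewrite (big_morph odd oddD (erefl : odd 0 = false)). Qed.

Lemma odd_digit_sum (n p : nat) :
  odd p -> odd (\sum_(i < n) bit n i * p ^ i) = odd (s2 n).
Proof.
move=> odd_p; rewrite /s2 !odd_sum; apply: eq_bigr => i _.
by rewrite oddM oddX odd_p orbT andbT.
Qed.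

Theorem lemma6 (n : nat) (n_ge1 : 1 <= n) : B n = m (n - 1) %[mod 2].
Proof.
rewrite !modn2 subn1 /m; congr nat_of_bool.
have [odd_n | even_n] := boolP (odd n).
  have Dn : n = n./2.*2.+1 by rewrite -[LHS]odd_double_half odd_n.
  have -> : odd (B n) = odd (s2 n).
    (* At n = 1 there is no prime factor; both sides are 1. *)
    rewrite /B; case: eqP => [->|_]; first by rewrite /s2 big_ord1.
    by apply: odd_digit_sum; apply: dvdn_odd (pdiv_dvd n) odd_n.
  rewrite Dn s2_doubleS /= odd_double doubleK /tbar.
  by case: (odd _).
have pdiv_n : pdiv n = 2.
  have n_gt1 : 1 < n by case: n n_ge1 even_n => [|[]].
  apply/eqP; rewrite eqn_leq (prime_gt1 (pdiv_prime n_gt1)) andbT.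
  by rewrite pdiv_min_dvd // dvdn2.
rewrite /B; case: eqP => [n1|_]; first by rewrite n1 in even_n.
rewrite pdiv_n -bit_expansion (negPf even_n).
(* Here n - 1 is odd, where [m] vanishes. *)
by case: n n_ge1 even_n {pdiv_n} => //= n _; rewrite negbK => ->.
Qed.
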